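(* Let $(\Omega,\mathcal F)$ be a measurable space, let $\mathcal C\subset\mathcal F$ be a sub-$\sigma$-algebra, and let $\rho:\mathbb F\to\mathbb R$ be a sublinear operator which is continuous from above on $\mathcal F$ and proper (with reference probability measure $P_0$). For $\xi\in\mathbb F$ let $\rho(\xi|\mathcal C)\in\mathbb C$ denote the minimum mean square estimator of $\xi$ with respect to $\mathcal C$. Then for any $\xi\in\mathbb F$ (all relations between estimators being understood $P_0$-a.s.): i) If $C_1\le\xi(\omega)\le C_2$ for two constants $C_1$ and $C_2$, then $C_1\le\rho(\xi|\mathcal C)\le C_2$. ii) $\rho(\lambda\xi|\mathcal C)=\lambda\rho(\xi|\mathcal C)$ for every $\lambda\in\mathbb R$. iii) For each $\eta_0\in\mathbb C$, $\rho(\xi+\eta_0|\mathcal C)=\rho(\xi|\mathcal C)+\eta_0$. iv) If under each $P\in\mathcal P$ the function $\xi$ is independent of $\mathcal C$, then $\rho(\xi|\mathcal C)$ is a constant.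
   Context: $\mathbb F$ denotes the set of all bounded $\mathcal F$-measurable real functions on $\Omega$ and $\mathbb C$ the set of all bounded $\mathcal C$-measurable real functions. A sublinear operator is a functional $\rho:\mathbb F\to\mathbb R$ such that: (i) $\rho(\xi_1)\ge\rho(\xi_2)$ if $\xi_1\ge\xi_2$; (ii) $\rho(c)=c$ for $c\in\mathbb R$; (iii) $\rho(\xi_1+\xi_2)\le\rho(\xi_1)+\rho(\xi_2)$ for all $\xi_1,\xi_2\in\mathbb F$; (iv) $\rho(\lambda\xi)=\lambda\rho(\xi)$ for $\lambda\ge0$. $\rho$ is continuous from above on $\mathcal F$ if for each sequence $(\xi_n)\subset\mathbb F$ with $\xi_n\downarrow0$ (pointwise) one has $\rho(\xi_n)\downarrow0$. $\mathcal P$ denotes the set of all linear functionals on $\mathbb F$ dominated by $\rho$. When $\rho$ is continuous from above, every element of $\mathcal P$ is (expectation $E_P$ under) a probability measure $P$ on $(\Omega,\mathcal F)$, $\rho(\xi)=\sup_{P\in\mathcal P}E_P[\xi]$ for $\xi\in\mathbb F$, and there is a probability measure $P_0$ on $(\Omega,\mathcal F)$ such that every $P\in\mathcal P$ is absolutely continuous with respect to $P_0$ and $\{dP/dP_0:P\in\mathcal P\}$ is $\sigma(L^1(P_0),L^\infty(P_0))$-compact; such a $P_0$ is fixed. $\rho$ is called proper if every $P\in\mathcal P$ is equivalent to $P_0$. If $\rho$ is a sublinear operator which is continuous from above on $\mathcal F$ and proper, then for every $\xi\in\mathbb F$ there exists an element $\hat\eta\in\mathbb C$, unique up to $P_0$-a.s.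 equality, with $\rho\big((\xi-\hat\eta)^2\big)=\inf_{\eta\in\mathbb C}\rho\big((\xi-\eta)^2\big)$. This $\hat\eta$ is the minimum mean square estimator $\rho(\xi|\mathcal C)$. *)

(* Defs.v *)
From HB Require Import structures.
From mathcomp Require Import all_boot all_order all_algebra.
From mathcomp Require Import all_classical all_reals all_analysis.
Set Implicit Arguments.
Unset Strict Implicit.
Unset Printing Implicit Defensive.
Import Order.TTheory GRing.Theory Num.Theory.
Import numFieldNormedType.Exports.
Local Open Scope classical_set_scope.
Local Open Scope ring_scope.

Section sublinear_operators.
Context d (T : measurableType d) (R : realType).

Definition bounded_measurable : set (T -> R) :=
  [set xi : T -> R | measurable_fun setT xi /\ bounded_fun xi].

(* The type [g_sigma_algebraType C] carries the sigma-algebra generated by [C],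
   which is [C] itself when [C] is a sigma-algebra. *)
Definition bounded_measurable_wrt (C : set_system T) : set (T -> R) :=
  [set eta : T -> R |
    @measurable_fun _ _ (g_sigma_algebraType C) R setT eta /\ bounded_fun eta].

(* A functional on the bounded measurable functions is represented by a total
   map [rho : (T -> R) -> R]; its values outside [bounded_measurable] are
   neither constrained nor used. *)
Implicit Type rho : (T -> R) -> R.

Record sublinear_operator rho : Prop := SublinearOperator {
  sublin_mono : forall xi1 xi2, bounded_measurable xi1 ->
    bounded_measurable xi2 -> (forall w, xi1 w >= xi2 w) ->
    rho xi1 >= rho xi2 ;
  sublin_cst : forall c : R, rho (cst c) = c ;
  sublin_subadd : forall xi1 xi2, bounded_measurable xi1 ->
    bounded_measurable xi2 ->
    rho (fun w => xi1 w + xi2 w) <= rho xi1 + rho xi2 ;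
  sublin_poshom : forall (l : R) xi, bounded_measurable xi -> 0 <= l ->
    rho (fun w => l * xi w) = l * rho xi
}.

Definition continuous_from_above rho : Prop :=
  forall xi : nat -> T -> R, (forall n, bounded_measurable (xi n)) ->
    (forall w, nonincreasing_seq (fun n => xi n w)
               /\ xi n w @[n --> \oo] --> (0 : R)) ->
    nonincreasing_seq (fun n => rho (xi n))
    /\ rho (xi n) @[n --> \oo] --> (0 : R).

Definition dominated_linear rho : set ((T -> R) -> R) :=
  [set L | (forall (a b : R) xi1 xi2, bounded_measurable xi1 ->
              bounded_measurable xi2 ->
              L (fun w => a * xi1 w + b * xi2 w) = a * L xi1 + b * L xi2)
           /\ (forall xi, bounded_measurable xi -> L xi <= rho xi)].

(* The probability measures whose expectation belongs to [dominated_linear rho];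
   when [rho] is sublinear and continuous from above, every element of
   [dominated_linear rho] agrees with such an expectation on
   [bounded_measurable]. *)
Definition dominated_probability rho : set (probability T R) :=
  [set P : probability T R | dominated_linear rho (fun xi => fine 'E_P[xi])].

Section weak_L1_topology.
Variable P0 : probability T R.

Local Notation L1 := (LfunType P0 (lexx (1%E : \bar R))).
Local Notation Linfty := (LfunType P0 (leey (1%E : \bar R))).

Definition L1_Linfty_pairing (f : L1) : {ptws Linfty -> R} :=
  fun g => \int[P0]_w (f w * g w).

(* The topology sigma(L^1(P0), L^oo(P0)), on integrable functions rather than on
   their classes modulo P0-a.e. equality.  It does not separate functions that
   are P0-a.e. equal, so a set stable under P0-a.e. equality is compact here iff
   its image in the quotient is compact. *)
Definition weak_L1 := initial_topology L1_Linfty_pairing.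
HB.instance Definition _ := Topological.on weak_L1.

(* All versions of dP/dP0, for P ranging over [dominated_probability rho]. *)
Definition dominated_densities rho : set weak_L1 :=
  [set f : L1 | exists2 P : probability T R, dominated_probability rho P &
    ae_eq P0 setT (EFin \o f)
      (Radon_Nikodym (charge_of_finite_measure P) P0)].

End weak_L1_topology.
Arguments dominated_densities P0 rho : clear implicits.

Definition reference_probability rho (P0 : probability T R) : Prop :=
  (forall P : probability T R, dominated_probability rho P -> P `<< P0)
  /\ compact (dominated_densities P0 rho).

Definition proper_operator rho (P0 : probability T R) : Prop :=
  forall P : probability T R, dominated_probability rho P ->
    P `<< P0 /\ P0 `<< P.

(* [etahat] is a version of the minimum mean square estimator rho(xi|C), which
   is only determined up to P0-a.s. equality. *)
Definition min_mean_square_estimator rho (C : set_system T) (xi : T -> R)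
    (etahat : T -> R) : Prop :=
  bounded_measurable_wrt C etahat /\
  rho (fun w => (xi w - etahat w) ^+ 2) =
    inf [set rho (fun w => (xi w - eta w) ^+ 2)
        | eta in bounded_measurable_wrt C].

Definition independent_of_sigma_algebra (P : probability T R) (xi : T -> R)
    (C : set_system T) : Prop :=
  forall (B : set R) (A : set T), measurable B -> C A ->
    P (xi @^-1` B `&` A) = (P (xi @^-1` B) * P A)%E.

End sublinear_operators.

(* Main.v *)
Require Import Defs.
From HB Require Import structures.
From mathcomp Require Import all_boot all_order all_algebra.
From mathcomp Require Import all_classical all_reals all_analysis.
From mathcomp Require Import measurable_realfun.
From mathcomp Require Import ring lra.
Set Implicit Arguments.
Unset Strict Implicit.
Unset Printing Implicit Defensive.
Import Order.TTheory GRing.Theory Num.Theory.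
Import numFieldNormedType.Exports.
Local Open Scope classical_set_scope.
Local Open Scope ring_scope.

(** Uniqueness of the estimator carries everything.  If [e1] and [e2] both
    minimise the risk [rho ((xi - eta)^2)] over the bounded [C]-measurable
    [eta], take a probability [P] in the family represented by [rho] whose
    expectation attains the supremum [rho ((xi - m)^2)] at the midpoint [m] of
    [e1] and [e2].  The parallelogram identity
      [(xi - m)^2 = ((xi - e1)^2 + (xi - e2)^2) / 2 - (e1 - e2)^2 / 4]
    then gives [min <= E_P (xi - m)^2 <= min - E_P (e1 - e2)^2 / 4], so
    [e1 = e2] holds [P]-a.s., hence [P0]-a.s. because [rho] is proper
    ([min_mean_square_estimator_unique]).

    The attained supremum comes from Hahn-Banach ([hahn_banach]) together with
    a Daniell-type representation: by continuity from above, a linear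
    functional dominated by [rho] is the expectation under a probability
    ([dominated_linear_representation]).

    Parts i), ii) and iii) follow by exhibiting a second minimiser: clamping an
    estimator to a range containing that of [xi] does not increase the risk,
    while scaling and [C]-measurable shifts act bijectively on the competitors
    (up to the trivial case of the factor 0).

    For iv), let [c] minimise the risk among constants and put [X = xi - c].
    The first-order condition at this minimum, read through Hahn-Banach, is the
    existence of one dominated [P] with [E_P X = 0] and [E_P X^2 = rho (X^2)]
    ([centred_maximizer]), so that [(P, c)] is a saddle point.  By independence,
    for every competitor [eta],
      [rho ((xi - eta)^2) >= E_P (X - (eta - c))^2
                           = E_P X^2 + E_P (eta - c)^2 >= rho (X^2)],
    so the constant [c] is an estimator, and uniqueness concludes. *)

(** * The Hahn-Banach theorem on a linear subspace *)

Section hahn_banach.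
Context (R : realType) (U : lmodType R) (V : set U).

Definition linear_subspace : Prop :=
  V 0 /\ forall (a b : R) x y, V x -> V y -> V (a *: x + b *: y).

(** The domain [V] is a predicate, and not a type of its own, because the
    functionals of interest are total maps controlled only on [V]. *)
Definition sublinear_on (p : U -> R) : Prop :=
  (forall x y, V x -> V y -> p (x + y) <= p x + p y) /\
  (forall (a : R) x, V x -> 0 <= a -> p (a *: x) = a * p x).

Definition linear_on (L : U -> R) : Prop :=
  forall (a b : R) x y, V x -> V y -> L (a *: x + b *: y) = a * L x + b * L y.

Context (Vlin : linear_subspace).

Lemma subspaceD x y : V x -> V y -> V (x + y).
Proof. by move=> Vx Vy; have := Vlin.2 1 1 _ _ Vx Vy; rewrite !scale1r. Qed.

Lemma subspaceZ (a : R) x : V x -> V (a *: x).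
Proof. by move=> Vx; have := Vlin.2 a 0 _ _ Vx Vx; rewrite scale0r addr0. Qed.

Lemma subspaceN x : V x -> V (- x).
Proof. by move=> Vx; rewrite -scaleN1r; exact: subspaceZ. Qed.

Lemma sublinear_on0 p : sublinear_on p -> p 0 = 0.
Proof. by case=> _ /(_ 0 0 Vlin.1 (lexx 0)); rewrite scale0r mul0r. Qed.

Lemma sublinear_onN p x : sublinear_on p -> V x -> - p (- x) <= p x.
Proof.
move=> ps Vx; have := ps.1 _ _ Vx (subspaceN Vx).
by rewrite subrr (sublinear_on0 ps); lra.
Qed.

(** Every sublinear functional built below is an infimum of this kind: of a
    chain, along a ray, or along a line.  The conditions say that the family is
    closed under sums and positive scalings up to decreasing the value. *)
Lemma sublinear_inf (I : Type) (D : set I) (F : I -> U -> R) :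
  D !=set0 ->
  (forall x, V x -> has_lbound [set F i x | i in D]) ->
  (forall i j x y, D i -> D j -> V x -> V y ->
    exists2 k, D k & F k (x + y) <= F i x + F j y) ->
  (forall i (a : R) x, D i -> V x -> 0 < a ->
    exists2 k, D k & F k (a *: x) <= a * F i x) ->
  (exists2 k, D k & F k 0 <= 0) ->
  sublinear_on (fun x => inf [set F i x | i in D]).
Proof.
move=> [i0 Di0] Flb FD FZ [k0 Dk0 Fk0]; set q := fun x => _.
have qF x i : V x -> D i -> q x <= F i x.
  by move=> Vx Di; apply: ge_inf; [exact: Flb | exists i].
have le_q x c : (forall i, D i -> c <= F i x) -> c <= q x.
  move=> h; apply: lb_le_inf; first by exists (F i0 x), i0.
  by move=> _ [i Di <-]; exact: h.
have qD x y : V x -> V y -> q (x + y) <= q x + q y.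
  move=> Vx Vy; rewrite -lerBlDr; apply: (le_q) => i Di.
  rewrite lerBlDr -lerBlDl; apply: (le_q) => j Dj; rewrite lerBlDl.
  by have [k Dk] := FD _ _ _ _ Di Dj Vx Vy; apply: le_trans; apply: qF => //;
    exact: subspaceD.
have qZ (a : R) x : V x -> 0 < a -> q (a *: x) <= a * q x.
  move=> Vx a0; rewrite mulrC -ler_pdivrMr//; apply: (le_q) => i Di.
  rewrite ler_pdivrMr// mulrC; have [k Dk] := FZ _ _ _ Di Vx a0.
  by apply: le_trans; apply: qF => //; exact: subspaceZ.
split=> // a x Vx; rewrite le_eqVlt => /orP[/eqP <-|a0].
  rewrite scale0r mul0r; apply/eqP; rewrite eq_le (le_trans (qF _ _ Vlin.1 Dk0))//=.
  by have := qD _ _ Vlin.1 Vlin.1; rewrite addr0; lra.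
apply/eqP; rewrite eq_le qZ//=.
have a10 : 0 < a^-1 by rewrite invr_gt0.
have := qZ _ _ (subspaceZ a Vx) a10.
by rewrite scalerA mulVf ?gt_eqF// scale1r ler_pdivlMl.
Qed.

(** The witness is [x |-> inf_(s >= 0) (p (x + s v) - s p v)]: the term [s = 0]
    gives the comparison with [p], the term [s = 1] the value at [- v].  It
    makes a minimal sublinear functional odd, and it starts the extension from
    a functional that already has the prescribed value at [v]. *)
Lemma sublinear_descent p v : sublinear_on p -> V v ->
  exists q, [/\ sublinear_on q, forall x, V x -> q x <= p x
    & q (- v) <= - p v].
Proof.
move=> ps Vv; pose F (s : R) x := p (x + s *: v) - s * p v.
pose D : set R := [set s | 0 <= s].
have D0 : D 0 by rewrite /D /=.
have Flb x : V x -> has_lbound [set F s x | s in D].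
  move=> Vx; exists (- p (- x)) => _ [s s0 <-]; rewrite /F.
  have Vsv := subspaceZ s Vv.
  have := ps.1 _ _ (subspaceD Vx Vsv) (subspaceN Vx).
  rewrite addrAC subrr add0r ps.2//; lra.
have qF x s : V x -> D s -> inf [set F i x | i in D] <= F s x.
  by move=> Vx Ds; apply: ge_inf; [exact: Flb | exists s].
exists (fun x => inf [set F s x | s in D]); split.
- apply: sublinear_inf => //; first by exists 0.
  + move=> s t x y Ds Dt Vx Vy; exists (s + t); first exact: addr_ge0.
    rewrite /F scalerDl addrACA.
    have := ps.1 _ _ (subspaceD Vx (subspaceZ s Vv))
      (subspaceD Vy (subspaceZ t Vv)).
    by rewrite mulrDl; lra.
  + move=> s a x Ds Vx a0; exists (a * s); first exact: mulr_ge0 (ltW a0) Ds.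
    rewrite /F -scalerA -scalerDr ps.2 ?(ltW a0)//.
      by rewrite mulrBr mulrA.
    exact: subspaceD (subspaceZ _ _).
  + by exists 0 => //; rewrite /F scale0r addr0 (sublinear_on0 ps) mul0r subr0.
- move=> x Vx; apply: (le_trans (qF x 0 Vx D0)).
  by rewrite /F scale0r addr0 mul0r subr0.
- apply: (le_trans (qF _ 1 (subspaceN Vv) ler01)).
  by rewrite /F scale1r addNr (sublinear_on0 ps) mul1r sub0r.
Qed.

(** Zorn's lemma for the reversed pointwise order on [V]; the infimum of a chain
    is finite because every [q <= p] satisfies [- p (- x) <= q x]. *)
Lemma exists_minimal_sublinear p : sublinear_on p ->
  exists q, [/\ sublinear_on q, forall x, V x -> q x <= p x
    & forall q', sublinear_on q' -> (forall x, V x -> q' x <= q x) ->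
        forall x, V x -> q x <= q' x].
Proof.
move=> ps; pose S := {q | sublinear_on q /\ forall x, V x -> q x <= p x}.
have p0 : sublinear_on p /\ forall x, V x -> p x <= p x by split.
pose ge (q1 q2 : S) := `[< forall x, V x -> sval q2 x <= sval q1 x >].
have [||A Atot|[q [qs qp]] qmin] := @ZL_preorder S (exist _ p p0) ge.
- by move=> q; apply/asboolP.
- move=> q r s /asboolP qr /asboolP rs; apply/asboolP => x Vx.
  exact: le_trans (rs x Vx) (qr x Vx).
- have [[q0 Aq0]|A0] := pselect (A !=set0); last first.
    exists (exist _ p p0) => s As; by exfalso; apply: A0; exists s.
  pose F (q : S) := sval q.
  have Flb x : V x -> has_lbound [set F i x | i in A].
    move=> Vx; exists (- p (- x)) => _ [[q [qs qp]] Aq <-] /=.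
    apply: le_trans (sublinear_onN qs Vx); rewrite lerN2.
    exact/qp/subspaceN.
  have qF x i : V x -> A i -> inf [set F i x | i in A] <= F i x.
    by move=> Vx Ai; apply: ge_inf; [exact: Flb | exists i].
  pose t x := inf [set F i x | i in A].
  have ts : sublinear_on t.
    apply: sublinear_inf => //; first by exists q0.
    + move=> i j x y Ai Aj Vx Vy.
      have [/asboolP ij|/asboolP ji] := Atot _ _ Ai Aj.
      * exists j => //; apply: le_trans ((svalP j).1.1 _ _ Vx Vy) _.
        by rewrite lerD2r; exact: ij.
      * exists i => //; apply: le_trans ((svalP i).1.1 _ _ Vx Vy) _.
        by rewrite lerD2l; exact: ji.
    + move=> i a x Ai Vx a0; exists i => //.
      by rewrite /F (svalP i).1.2 ?(ltW a0).
    + by exists q0 => //; rewrite /F (sublinear_on0 (svalP q0).1).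
  have tp x : V x -> inf [set F i x | i in A] <= p x.
    by move=> Vx; apply: le_trans (qF _ _ Vx Aq0) ((svalP q0).2 _ Vx).
  have t_ub : sublinear_on t /\ forall x, V x -> t x <= p x by split.
  exists (exist _ t t_ub) => s As; apply/asboolP => x Vx /=.
  exact: qF.
- exists q; split => // q' q's q'q x Vx.
  have q'p y : V y -> q' y <= p y.
    by move=> Vy; exact: le_trans (q'q _ Vy) (qp _ Vy).
  have := qmin (exist _ q' (conj q's q'p)).
  by move=> /(_ (asboolT q'q))/asboolP; exact.
Qed.

(** Minimality against the descent in the direction of [x] forces
    [q (- x) = - q x], and an odd sublinear functional is linear. *)
Lemma minimal_sublinear_linear q : sublinear_on q ->
  (forall q', sublinear_on q' -> (forall x, V x -> q' x <= q x) ->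
    forall x, V x -> q x <= q' x) ->
  linear_on q.
Proof.
move=> qs qmin.
have qN x : V x -> q (- x) = - q x.
  move=> Vx; have [q' [q's q'q q'x]] := sublinear_descent qs Vx.
  have := qmin _ q's q'q _ (subspaceN Vx).
  have := sublinear_onN qs Vx; lra.
have qD x y : V x -> V y -> q (x + y) = q x + q y.
  move=> Vx Vy; have := qs.1 _ _ Vx Vy.
  have := qs.1 _ _ (subspaceD Vx Vy) (subspaceN Vy).
  rewrite addrK (qN _ Vy); lra.
have qZ (a : R) x : V x -> q (a *: x) = a * q x.
  move=> Vx; have [a0|a0] := leP 0 a; first exact: qs.2.
  rewrite -[a]opprK scaleNr qN; last exact: subspaceZ.
  by rewrite qs.2 ?oppr_ge0 ?(ltW a0)//; ring.
by move=> a b x y Vx Vy; rewrite qD ?qZ//; exact: subspaceZ.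
Qed.

Theorem hahn_banach p x0 : sublinear_on p -> V x0 ->
  exists L, [/\ linear_on L, forall x, V x -> L x <= p x & L x0 = p x0].
Proof.
move=> ps Vx0; have [q [qs qp qx0]] := sublinear_descent ps Vx0.
have [L [Ls Lq Lmin]] := exists_minimal_sublinear qs.
have Ll := minimal_sublinear_linear Ls Lmin.
have Lp x : V x -> L x <= p x.
  by move=> Vx; exact: le_trans (Lq _ Vx) (qp _ Vx).
exists L; split => //; apply/eqP; rewrite eq_le Lp//=.
have := Lq _ (subspaceN Vx0).
have := Ll (-1) 0 _ _ Vx0 Vx0.
rewrite scale0r addr0 scaleN1r; lra.
Qed.

End hahn_banach.

(** * Truncation to an interval *)

Definition clamp (R : realType) (a b t : R) : R := Num.max a (Num.min b t).

Lemma clamp_itv (R : realType) (a b t : R) : a <= b -> a <= clamp a b t <= b.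
Proof. by move=> ab; rewrite /clamp le_max lexx ge_max ab ge_min lexx. Qed.

Lemma clamp_id (R : realType) (a b t : R) : a <= t <= b -> clamp a b t = t.
Proof. by move=> /andP[a_t tb]; rewrite /clamp min_r// max_r. Qed.

(** Projecting onto an interval that contains [x] brings a point closer to
    [x]. *)
Lemma sqr_clamp (R : realType) (a b x t : R) : a <= x <= b ->
  (x - clamp a b t) ^+ 2 <= (x - t) ^+ 2.
Proof.
rewrite /clamp => /andP[ax xb].
have [bt|tb] := leP b t.
  by rewrite max_r ?(le_trans ax)// !expr2; nra.
by have [at_|ta] := leP a t => //; rewrite !expr2; nra.
Qed.

(** * Bounded measurable functions and positive linear functionals *)

Section bounded_measurable.
Context d (T : measurableType d) (R : realType).
Implicit Types (f g : T -> R).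
Local Notation bm := (@bounded_measurable d T R).

Lemma bounded_measurableP f :
  bm f <-> measurable_fun setT f /\ exists M : R, forall w, `|f w| <= M.
Proof.
split=> [[mf bf]|[mf [M fM]]]; split => //.
  have [M [_ fM]] := bf; exists (M + 1) => w.
  by apply: fM => //; rewrite ltrDl.
exists M; split=> [|N MN w _]; first exact: num_real.
exact: le_trans (fM w) (ltW MN).
Qed.

Lemma bounded_measurable_bound f :
  bm f -> exists2 M : R, 0 <= M & forall w, - M <= f w <= M.
Proof.
move=> /bounded_measurableP[_ [M fM]]; exists `|M| => // w.
by rewrite -ler_norml (le_trans (fM w))// ler_norm.
Qed.

Lemma bounded_measurable_cst (c : R) : bm (cst c).
Proof. by apply/bounded_measurableP; split => //; exists `|c|. Qed.

Lemma bounded_measurable_indic (A : set T) : measurable A -> bm \1_A.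
Proof.
move=> mA; apply/bounded_measurableP; split; first exact: measurable_indic.
by exists 1 => w; rewrite indicE; case: (w \in A); rewrite ?normr1 ?normr0.
Qed.

Lemma bounded_measurableM f g : bm f -> bm g -> bm (fun w => f w * g w).
Proof.
move=> /bounded_measurableP[mf [M fM]] /bounded_measurableP[mg [N gN]].
apply/bounded_measurableP; split; first exact: measurable_funM.
by exists (M * N) => w; rewrite normrM ler_pM.
Qed.

Lemma bounded_measurableD f g : bm f -> bm g -> bm (fun w => f w + g w).
Proof.
move=> /bounded_measurableP[mf [M fM]] /bounded_measurableP[mg [N gN]].
apply/bounded_measurableP; split; first exact: measurable_funD.
by exists (M + N) => w; rewrite (le_trans (ler_normD _ _)) ?lerD.
Qed.

Lemma bounded_measurableZ (a : R) f : bm f -> bm (fun w => a * f w).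
Proof. by apply: bounded_measurableM; exact: bounded_measurable_cst. Qed.

Lemma bounded_measurable_lin (a b : R) f g :
  bm f -> bm g -> bm (fun w => a * f w + b * g w).
Proof.
by move=> bf bg; apply: bounded_measurableD; exact: bounded_measurableZ.
Qed.

Lemma bounded_measurableB f g : bm f -> bm g -> bm (fun w => f w - g w).
Proof.
move=> bf bg; rewrite (_ : (fun w => _) = (fun w => 1 * f w + (- 1) * g w)).
  exact: bounded_measurable_lin.
by apply/funext => w; ring.
Qed.

Lemma bounded_measurable_sqr f : bm f -> bm (fun w => f w ^+ 2).
Proof. by move=> bf; exact: bounded_measurableM. Qed.

Lemma bounded_measurable_clamp (a b : R) f : measurable_fun setT f ->
  bm (fun w => clamp a b (f w)).
Proof.
move=> mf; apply/bounded_measurableP; split.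
  by apply: measurable_maxr => //; exact: measurable_minr.
exists (`|a| + `|b|) => w; rewrite /clamp ler_norml le_max ge_max ge_min.
have := ler_norm a; have := ler_norm b; have := ler_norm (- a).
have := normr_ge0 b; rewrite normrN => *.
apply/andP; split; first by apply/orP; left; lra.
by apply/andP; split; [|apply/orP; left]; lra.
Qed.

Lemma bounded_measurable_subspace : @linear_subspace R (T -> R) bm.
Proof.
split; first exact: bounded_measurable_cst 0.
move=> a b f g bf bg; exact: bounded_measurable_lin.
Qed.

Definition linear_functional (L : (T -> R) -> R) : Prop :=
  forall (a b : R) f g, bm f -> bm g ->
    L (fun w => a * f w + b * g w) = a * L f + b * L g.

Definition positive_functional (L : (T -> R) -> R) : Prop :=
  forall f, bm f -> (forall w, 0 <= f w) -> 0 <= L f.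

Lemma linear_functional0 L : linear_functional L -> L (cst 0) = 0.
Proof.
move=> Ll; have b0 := bounded_measurable_cst 0.
have := Ll 0 0 _ _ b0 b0; rewrite !mul0r addr0; apply: etrans.
by congr L; apply/funext => w; rewrite /= mul0r addr0.
Qed.

Lemma linear_functionalD L f g : linear_functional L -> bm f -> bm g ->
  L (fun w => f w + g w) = L f + L g.
Proof.
move=> Ll bf bg; have := Ll 1 1 _ _ bf bg; rewrite !mul1r => <-.
by congr L; apply/funext => w; rewrite !mul1r.
Qed.

Lemma linear_functionalB L f g : linear_functional L -> bm f -> bm g ->
  L (fun w => f w - g w) = L f - L g.
Proof.
move=> Ll bf bg; have := Ll 1 (-1) _ _ bf bg; rewrite mul1r mulN1r => <-.
by congr L; apply/funext => w; rewrite mul1r mulN1r.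
Qed.

Lemma linear_functionalZ L (a : R) f : linear_functional L -> bm f ->
  L (fun w => a * f w) = a * L f.
Proof.
move=> Ll bf; have := Ll a 0 _ _ bf bf; rewrite mul0r addr0 => <-.
by congr L; apply/funext => w; rewrite mul0r addr0.
Qed.

Lemma positive_linear_mono L f g : linear_functional L ->
  positive_functional L -> bm f -> bm g -> (forall w, f w <= g w) -> L f <= L g.
Proof.
move=> Ll Lp bf bg fg; rewrite -subr_ge0 -linear_functionalB//.
by apply: Lp => [|w]; [exact: bounded_measurableB | rewrite subr_ge0].
Qed.

(** The layer-cake step function of [f >= 0] with mesh [e]: it equals [k e] where
    [k e <= f < (k + 1) e], as long as [f] stays below [n e]. *)
Let step (e : R) f n : T -> R :=
  fun w => \sum_(k < n) e * \1_[set x | k.+1%:R * e <= f x] w.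

Let stepS e f n : step e f n.+1 =
  fun w => step e f n w + e * \1_[set x | n.+1%:R * e <= f x] w.
Proof. by apply/funext => w; rewrite /step big_ord_recr. Qed.

Let step_level (e : R) f w n : 0 < e -> 0 <= f w ->
  if n%:R * e <= f w then step e f n w = n%:R * e
  else step e f n w <= f w <= step e f n w + e.
Proof.
move=> e0 f0; elim: n => [|n]; first by rewrite mul0r f0 /step big_ord0.
rewrite stepS indicE; have ne : n.+1%:R * e = n%:R * e + e.
  by rewrite -natr1 mulrDl mul1r.
have [h1|h1] := leP (n.+1%:R * e) (f w).
  rewrite mem_set//= ne ifT; last by lra.
  by move=> ->; rewrite mulr1.
rewrite memNset/= ?mulr0 ?addr0; last by apply/negP; rewrite -ltNge.
case: leP => // h2 ->; rewrite h2 /=; lra.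
Qed.

Let measurable_superlevel f (c : R) : bm f -> measurable [set x | c <= f x].
Proof.
move=> [mf _]; rewrite (_ : mkset _ = setT `&` f @^-1` `[c, +oo[%classic).
  by apply: mf => //; exact: measurable_itv.
by rewrite setTI; apply/seteqP; split => x; rewrite /= in_itv/= andbT.
Qed.

Let bounded_measurable_step e f n : bm f -> bm (step e f n).
Proof.
move=> bf; elim: n => [|n IHn].
  rewrite (_ : step e f 0 = cst 0); first exact: bounded_measurable_cst.
  by apply/funext => w; rewrite /step big_ord0.
rewrite stepS; apply: bounded_measurableD => //; apply: bounded_measurableZ.
by apply: bounded_measurable_indic; exact: measurable_superlevel.
Qed.

(** A nonnegative [f] lies uniformly within [e] of a finite combination of
    indicators, and positivity turns this into a bound [e * L (cst 1)] on the
    error.  The lemma thus applies to functionals not yet known to be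
    integrals. *)
Lemma positive_linear_ext L1 L2 :
  linear_functional L1 -> positive_functional L1 ->
  linear_functional L2 -> positive_functional L2 ->
  (forall A, measurable A -> L1 \1_A = L2 \1_A) ->
  forall f, bm f -> L1 f = L2 f.
Proof.
move=> l1 p1 l2 p2 L12.
have L12cst c : L1 (cst c) = L2 (cst c).
  rewrite (_ : cst c = fun w => c * \1_[set: T] w).
    by rewrite !linear_functionalZ ?L12//; exact: bounded_measurable_indic.
  by apply/funext => w; rewrite indicE in_setT mulr1.
have L12step e f n : bm f -> L1 (step e f n) = L2 (step e f n).
  move=> bf; elim: n => [|n IHn].
    rewrite (_ : step e f 0 = cst 0)//.
    by apply/funext => w; rewrite /step big_ord0.
  have bi : bm (\1_[set x | n.+1%:R * e <= f x] : T -> R).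
    by apply: bounded_measurable_indic; exact: measurable_superlevel.
  have bs := bounded_measurable_step e n bf; have bei := bounded_measurableZ e bi.
  rewrite stepS !linear_functionalD// IHn !linear_functionalZ//.
  by rewrite L12//; exact: measurable_superlevel.
have L12ge0 f : bm f -> (forall w, 0 <= f w) -> L1 f = L2 f.
  move=> bf f0; have [_ [M fM]] := (bounded_measurableP f).1 bf.
  have c0 : 0 <= L1 (cst 1) by apply: p1 => //; exact: bounded_measurable_cst.
  have close (e : R) : 0 < e -> `|L1 f - L2 f| <= e * L1 (cst 1).
    move=> e0; have [n Mn] : exists n : nat, M < n%:R * e.
      exists (Num.trunc (M / e)).+1; rewrite -ltr_pdivrMr//.
      exact/real_truncnS_gt/num_real.
    have fn w : step e f n w <= f w <= step e f n w + e.
      have := step_level n e0 (f0 w); rewrite ifF//; apply/negbTE.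
      rewrite -ltNge; apply: le_lt_trans Mn.
      by apply: le_trans (fM w); rewrite ler_norm.
    have bs := bounded_measurable_step e n bf.
    have be := bounded_measurable_cst e.
    have eL L : linear_functional L -> L (cst e) = e * L (cst 1).
      move=> Ll; rewrite -linear_functionalZ//; last exact: bounded_measurable_cst.
      by congr L; apply/funext => w; rewrite mulr1.
    have bound L : linear_functional L -> positive_functional L ->
        L (step e f n) <= L f <= L (step e f n) + e * L (cst 1).
      move=> Ll Lp; rewrite -eL// -linear_functionalD//.
      apply/andP; split; apply: positive_linear_mono => //.
      - by move=> w; have /andP[] := fn w.
      - exact: bounded_measurableD.
      - by move=> w; have /andP[] := fn w.
    have := bound _ l1 p1; have := bound _ l2 p2.
    rewrite -L12step// -L12cst ler_norml; lra.
  apply/eqP; rewrite -subr_eq0 -normr_le0; apply/ler_addgt0Pl => e e0.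
  rewrite addr0; have c1 : 0 < L1 (cst 1) + 1 by lra.
  apply: le_trans (close (e / (L1 (cst 1) + 1)) _) _; first exact: divr_gt0.
  by rewrite mulrAC ler_pdivrMr// ler_pM2l//; lra.
move=> f bf; have [_ [M fM]] := (bounded_measurableP f).1 bf.
have bM := bounded_measurable_cst M.
have : L1 (fun w => f w + cst M w) = L2 (fun w => f w + cst M w).
  apply: L12ge0; first exact: bounded_measurableD.
  by move=> w; have := fM w; rewrite /= ler_norml; lra.
by rewrite !linear_functionalD// L12cst => /addIr.
Qed.

End bounded_measurable.

Arguments bounded_measurable_cst {d T R} c.

(** * Dominated linear functionals are expectations *)

Section expectation.
Context d (T : measurableType d) (R : realType) (P : probability T R).
Local Notation bm := (@bounded_measurable d T R).

Lemma bounded_measurable_integrable f : bm f -> P.-integrable setT (EFin \o f).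
Proof.
move=> [mf bf]; apply: measurable_bounded_integrable => //.
exact: fin_num_fun_lty.
Qed.

Lemma expectationE f : fine 'E_P[f] = \int[P]_w f w.
Proof. by rewrite unlock. Qed.

Lemma expectation_linear : linear_functional (fun f : T -> R => fine 'E_P[f]).
Proof.
move=> a b f g bf bg; rewrite !expectationE RintegralD//.
- by rewrite !RintegralZl//; exact: bounded_measurable_integrable.
- exact/bounded_measurable_integrable/bounded_measurableZ.
- exact/bounded_measurable_integrable/bounded_measurableZ.
Qed.

Lemma expectation_positive :
  positive_functional (fun f : T -> R => fine 'E_P[f]).
Proof. by move=> f bf f0; rewrite expectationE Rintegral_ge0. Qed.

Lemma expectation_indic A : measurable A ->
  fine 'E_P[(\1_A : T -> R)] = fine (P A).
Proof. by move=> mA; rewrite unlock integral_indic// setIT. Qed.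

End expectation.

Section representation.
Context d (T : measurableType d) (R : realType) (rho : (T -> R) -> R).
Context (rho_sublin : sublinear_operator rho).
Local Notation bm := (@bounded_measurable d T R).

(** If [0 <= f] then [- L f = L (- f) <= rho (- f) <= rho 0 = 0]. *)
Lemma dominated_linear_positive L : dominated_linear rho L ->
  positive_functional L.
Proof.
move=> [Ll Lr] f bf f0; rewrite -oppr_le0 -mulN1r -linear_functionalZ//.
apply: le_trans (Lr _ (bounded_measurableZ _ bf)) _.
rewrite -(sublin_cst rho_sublin 0); apply: (sublin_mono rho_sublin) => //.
- exact: bounded_measurable_cst.
- exact: bounded_measurableZ.
- by move=> w; rewrite /= mulN1r oppr_le0.
Qed.

Lemma dominated_linear_cst L c : dominated_linear rho L -> L (cst c) = c.
Proof.
move=> [Ll Lr].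
have le1 a : L (cst a) <= a.
  by rewrite -[leRHS](sublin_cst rho_sublin); exact/Lr/bounded_measurable_cst.
apply/eqP; rewrite eq_le le1/=.
have := le1 (- c); rewrite (_ : cst (- c) = fun w => -1 * cst c w).
  by rewrite linear_functionalZ//; [lra | exact: bounded_measurable_cst].
by apply/funext => w; rewrite /= mulN1r.
Qed.

Context (rho_cont : continuous_from_above rho).

Let indicU (A B : set T) : A `&` B = set0 ->
  (\1_(A `|` B) : T -> R) = (fun w => \1_A w + \1_B w).
Proof.
move=> AB; apply/funext => w; rewrite !indicE in_setU.
have := in_setI w A B; rewrite AB in_set0.
by case: (w \in A); case: (w \in B) => //= _; rewrite ?addr0 ?add0r.
Qed.

(** The error after [n] terms is [L] of the indicator of the tail
    [\bigcup_(i >= n) F i].  These indicators decrease pointwise to 0, so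
    continuity from above makes [rho], and with it [L], tend to 0 on them. *)
Lemma dominated_linear_sigma_additive L (F : (set T)^nat) :
  dominated_linear rho L -> (forall n, measurable (F n)) ->
  trivIset setT F ->
  \sum_(i < n) L \1_(F i) @[n --> \oo] --> L \1_(\bigcup_n F n).
Proof.
move=> Ldom mF tF; have [Ll Lr] := Ldom.
pose G n := \bigcup_(i in [set i | (n <= i)%N]) F i.
have mG n : measurable (G n) by exact: bigcup_measurable.
have bG n : bm (\1_(G n) : T -> R) by exact: bounded_measurable_indic.
have GS n : G n = F n `|` G n.+1.
  apply/seteqP; split => [w [i /= ni Fw]|w [Fw|[i /= ni Fw]]].
  - move: ni; rewrite leq_eqVlt => /predU1P[->|ni]; first by left.
    by right; exists i.
  - by exists n => /=.
  - by exists i => //=; exact: ltnW.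
have FG n : F n `&` G n.+1 = set0.
  apply/seteqP; split => // w [Fn [i /= ni Fi]].
  have ei : n = i by apply: tF => //; exists w.
  by rewrite ei ltnn in ni.
have sumG n : \sum_(i < n) L \1_(F i) = L \1_(\bigcup_n F n) - L \1_(G n).
  elim: n => [|n IHn].
    rewrite big_ord0 (_ : G 0%N = \bigcup_n F n) ?subrr//.
    by rewrite /G; congr bigcup; apply/seteqP; split.
  rewrite big_ord_recr/= IHn GS indicU// linear_functionalD//.
    by ring.
  exact: bounded_measurable_indic.
under eq_cvg do rewrite sumG.
suff LG0 : L \1_(G n) @[n --> \oo] --> (0 : R).
  have := cvgB (cvg_cst (L \1_(\bigcup_n F n))) LG0.
  by rewrite subr0; exact.
have [|_ rG0] := rho_cont bG.
  move=> w; split.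
    move=> m n mn; rewrite !indicE.
    have [Gw|] := boolP (w \in G n); last by rewrite ler0n.
    rewrite mem_set//; move: Gw; rewrite inE => -[i /= ni Fi].
    by exists i => //=; exact: leq_trans ni.
  have [[k _ Fk]|nF] := pselect ((\bigcup_n F n) w); last first.
    rewrite (_ : (fun n => _) = cst 0); first exact: cvg_cst.
    apply/funext => n; rewrite indicE memNset//= => -[i _ Fi].
    by apply: nF; exists i.
  apply: cvg_near_cst; exists k.+1 => // n /= kn.
  apply/eqP; rewrite indicE memNset//= => -[i /= ni Fi].
  have ei : k = i by apply: tF => //; exists w.
  by move: (leq_trans kn ni); rewrite ei ltnn.
apply: (@squeeze_cvgr _ _ _ _ (cst 0) (fun n => rho \1_(G n))) => //.
- near=> n; rewrite Lr// andbT; apply: dominated_linear_positive => //.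
- exact: cvg_cst.
Unshelve. all: by end_near. Qed.

Section probability_of_functional.
Context (L : (T -> R) -> R) (Ldom : dominated_linear rho L).

(** On a nonmeasurable set the value of [L] is arbitrary, while a measure must be
    nonnegative on all sets: hence the absolute value. *)
Let mu (A : set T) : \bar R := `|L \1_A|%:E.

Let muE A : measurable A -> mu A = (L \1_A)%:E.
Proof.
move=> mA; rewrite /mu ger0_norm//; apply: dominated_linear_positive => //.
exact: bounded_measurable_indic.
Qed.

Let mu0 : mu set0 = 0%E.
Proof.
rewrite muE// indic0; congr EFin.
exact: (linear_functional0 Ldom.1).
Qed.

Let mu_ge0 A : (0 <= mu A)%E.
Proof. by rewrite lee_fin. Qed.

Let mu_sigma_additive : semi_sigma_additive mu.
Proof.
move=> F mF tF mU; rewrite muE//.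
under eq_cvg.
  move=> n; rewrite (eq_bigr (fun i => (L \1_(F i))%:E)); last first.
    by move=> i _; rewrite muE.
  rewrite sumEFin big_mkord; over.
apply: cvg_EFin; first by near=> n.
exact: dominated_linear_sigma_additive.
Unshelve. all: by end_near. Qed.

HB.instance Definition _ :=
  isMeasure.Build _ _ _ mu mu0 mu_ge0 mu_sigma_additive.

Let mu_setT : mu setT = 1%E.
Proof. by rewrite muE// indicT dominated_linear_cst. Qed.

HB.instance Definition _ := Measure_isProbability.Build _ _ _ mu mu_setT.

Lemma dominated_linear_representation :
  exists2 P : probability T R, dominated_probability rho P &
    forall f, bm f -> fine 'E_P[f] = L f.
Proof.
pose P : probability T R := mu.
have EPL f : bm f -> fine 'E_P[f] = L f.
  apply: (@positive_linear_ext _ _ _ (fun f => fine 'E_P[f]) L) => //.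
  - exact: expectation_linear.
  - exact: expectation_positive.
  - exact: Ldom.1.
  - exact: dominated_linear_positive.
  - by move=> A mA; rewrite expectation_indic// -[RHS]/(fine (L \1_A)%:E) -(muE mA).
exists P => //; split; first exact: expectation_linear.
by move=> f bf; rewrite EPL//; exact: Ldom.2.
Qed.

End probability_of_functional.
End representation.
(** * Attained suprema and uniqueness of the estimator *)

Section attained_supremum.
Context d (T : measurableType d) (R : realType) (rho : (T -> R) -> R).
Context (rho_sublin : sublinear_operator rho).
Context (rho_cont : continuous_from_above rho).
Local Notation bm := (@bounded_measurable d T R).

Lemma sublinear_operator_sublinear_on :
  @sublinear_on R (T -> R) bm rho.
Proof.
split=> [f g bf bg|a f bf a0]; first exact: sublin_subadd.
exact: sublin_poshom.
Qed.

(** Allowing any sublinear [p] below [rho], instead of [rho] alone, makes it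
    possible to impose further linear constraints on [P]. *)
Lemma attained_supremum p f : @sublinear_on R (T -> R) bm p ->
  (forall g, bm g -> p g <= rho g) -> bm f ->
  exists P : probability T R, [/\ dominated_probability rho P,
    fine 'E_P[f] = p f & forall g, bm g -> fine 'E_P[g] <= p g].
Proof.
move=> ps pr bf.
have [L [Ll Lp Lf]] :=
  hahn_banach (@bounded_measurable_subspace d T R) ps bf.
have Ldom : dominated_linear rho L.
  split=> [a b g h bg bh|g bg]; first exact: Ll.
  exact: le_trans (Lp _ bg) (pr _ bg).
have [P Pdom PL] := dominated_linear_representation rho_sublin rho_cont Ldom.
by exists P; split => // [|g bg]; rewrite PL//; exact: Lp.
Qed.

End attained_supremum.

Section estimator.
Context d (T : measurableType d) (R : realType) (C : set_system T).
Context (C_sigma : sigma_algebra setT C) (C_sub : C `<=` measurable).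
Context (rho : (T -> R) -> R) (rho_sublin : sublinear_operator rho).
Local Notation bm := (@bounded_measurable d T R).
Local Notation bmC := (@bounded_measurable _ (g_sigma_algebraType C) R).

Lemma bounded_measurable_wrtW f : bmC f -> bm f.
Proof.
move=> [mf bf]; split=> // _ Y mY; apply: C_sub.
rewrite -(sigma_algebra_id C_sigma); exact: mf.
Qed.

(** The infimum in the definition is a genuine one because risks are
    nonnegative, so it can be traded for pointwise comparisons. *)
Lemma min_mean_square_estimatorP xi etahat : bm xi ->
  min_mean_square_estimator rho C xi etahat <->
  bmC etahat /\ forall eta, bmC eta ->
    rho (fun w => (xi w - etahat w) ^+ 2) <= rho (fun w => (xi w - eta w) ^+ 2).
Proof.
move=> bxi.
have risk_ge0 eta : bmC eta -> 0 <= rho (fun w => (xi w - eta w) ^+ 2).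
  move=> /bounded_measurable_wrtW be; rewrite -(sublin_cst rho_sublin 0).
  apply: (sublin_mono rho_sublin) => [||w]; last exact: sqr_ge0.
    exact/bounded_measurable_sqr/bounded_measurableB.
  exact: bounded_measurable_cst.
split=> [[be e_inf]|[be e_le]]; split => //.
  move=> eta beta; rewrite e_inf; apply: ge_inf; last by exists eta.
  by exists 0 => _ [e bme <-]; exact: risk_ge0.
apply/eqP; rewrite eq_le; apply/andP; split.
  apply: lb_le_inf; first by exists (rho (fun w => (xi w - etahat w) ^+ 2)), etahat.
  by move=> _ [eta beta <-]; exact: e_le.
apply: ge_inf; last by exists etahat.
by exists 0 => _ [e bme <-]; exact: risk_ge0.
Qed.

Context (rho_cont : continuous_from_above rho).
Context (P0 : probability T R) (rho_proper : proper_operator rho P0).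

(** Strict convexity of the risk along the segment from [e1] to [e2], tested
    with a probability maximising the risk of the midpoint. *)
Lemma min_mean_square_estimator_unique xi e1 e2 : bm xi ->
  min_mean_square_estimator rho C xi e1 ->
  min_mean_square_estimator rho C xi e2 -> {ae P0, forall w, e1 w = e2 w}.
Proof.
move=> bxi /min_mean_square_estimatorP-/(_ bxi)[bC1 min1].
move=> /min_mean_square_estimatorP-/(_ bxi)[bC2 min2].
have be1 := bounded_measurable_wrtW bC1.
have be2 := bounded_measurable_wrtW bC2.
pose mid w := 2^-1 * e1 w + 2^-1 * e2 w.
have bCmid : bmC mid by exact: bounded_measurable_lin.
have bmid := bounded_measurable_wrtW bCmid.
pose sq eta w := (xi w - eta w) ^+ 2.
have bsq eta : bm eta -> bm (sq eta).
  by move=> ?; exact/bounded_measurable_sqr/bounded_measurableB.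
pose D w := (e1 w - e2 w) ^+ 2.
have bD : bm D by exact/bounded_measurable_sqr/bounded_measurableB.
have [P [Pdom Pmid _]] := attained_supremum rho_sublin rho_cont
  (sublinear_operator_sublinear_on rho_sublin) (fun g _ => lexx _) (bsq _ bmid).
have Ple f bf := Pdom.2 f bf.
have ED : fine 'E_P[D] = 0.
  apply/eqP; rewrite eq_le expectation_positive ?andbT//; last first.
    by move=> w; exact: sqr_ge0.
  have par : fine 'E_P[sq mid] =
      2^-1 * fine 'E_P[sq e1] + 2^-1 * fine 'E_P[sq e2] - 4^-1 * fine 'E_P[D].
    have bs1 := bsq _ be1; have bs2 := bsq _ be2.
    have EL := @expectation_linear _ _ _ P.
    have /= <- := EL 2^-1 2^-1 _ _ bs1 bs2.
    have /= := EL 1 (- 4^-1) _ _ (bounded_measurable_lin 2^-1 2^-1 bs1 bs2) bD.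
    rewrite mul1r mulNr => <-.
    by congr (fine 'E_P[_]); apply/funext => w; rewrite /sq /mid /D; field.
  have := Ple _ (bsq _ be1); have := Ple _ (bsq _ be2).
  have := min1 _ bC2; have := min2 _ bC1; have := min1 _ bCmid.
  rewrite -/(sq e1) -/(sq e2) -/(sq mid); lra.
have [_ P0P] := rho_proper Pdom.
have aeD : ae_eq P setT (EFin \o D) (cst 0%E).
  apply/ae_eq_integral_abs => //; first by apply/measurable_EFinP; case: bD.
  rewrite -(@fineK _ (\int[P]_x _)%E).
    under eq_integral do rewrite gee0_abs ?lee_fin ?sqr_ge0//.
    by move: ED; rewrite unlock => ->.
  under eq_integral do rewrite gee0_abs ?lee_fin ?sqr_ge0//.
  by apply: integrable_fin_num => //; exact: bounded_measurable_integrable.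
have := null_dominates_ae_eq measurableT P0P aeD.
apply: filterS => w /(_ Logic.I)[] /eqP.
by rewrite sqrf_eq0 subr_eq0 => /eqP.
Qed.

End estimator.

(** * Product rule under independence *)

Section independence.
Context d (T : measurableType d) (R : realType) (C : set_system T).
Context (C_sigma : sigma_algebra setT C) (C_sub : C `<=` measurable).
Context (P : probability T R) (xi : T -> R).
Context (xi_bm : bounded_measurable xi).
Context (xi_indep : independent_of_sigma_algebra P xi C).
Local Notation bm := (@bounded_measurable d T R).
Local Notation bmR := (@bounded_measurable _ R R).
Local Notation bmC := (@bounded_measurable _ (g_sigma_algebraType C) R).
Local Notation E f := (fine 'E_P[f]).

Let EL : linear_functional (fun f : T -> R => E f).
Proof. exact: expectation_linear. Qed.

Let EP : positive_functional (fun f : T -> R => E f).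
Proof. exact: expectation_positive. Qed.

Let bm_comp (h : R -> R) : bmR h -> bm (h \o xi).
Proof.
move=> /bounded_measurableP[mh [M hM]]; apply/bounded_measurableP.
split; last by exists M => w; exact: hM.
by apply: measurableT_comp => //; case: xi_bm.
Qed.

(** As functionals of [h], [E (h xi * 1_A)] and [E (h xi) * E 1_A] agree on
    indicators of Borel sets by independence.  Since [xi] is bounded, it is
    [h xi] for the bounded Borel function [h] that clamps to its range. *)
Lemma expectation_indep_indic (A : set T) : C A ->
  E (fun w => xi w * \1_A w) = E xi * E \1_A.
Proof.
move=> CA; have mA := C_sub CA.
have bA : bm (\1_A : T -> R) by exact: bounded_measurable_indic.
have [M _ xiM] := bounded_measurable_bound xi_bm.
have bclamp : bmR (fun x => clamp (- M) M x).
  by apply: bounded_measurable_clamp; exact: measurable_id.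
have xi_clamp : (fun x => clamp (- M) M x) \o xi = xi.
  by apply/funext => w; rewrite /= clamp_id.
have EAge0 : 0 <= E \1_A by apply: EP => // w.
rewrite -xi_clamp.
apply: (@positive_linear_ext _ _ _ (fun h => E (fun w => (h \o xi) w * \1_A w))
  (fun h => E (h \o xi) * E \1_A) _ _ _ _ _ _ bclamp).
- move=> a b f g bf bg /=.
  have := EL a b (bounded_measurableM (bm_comp bf) bA)
    (bounded_measurableM (bm_comp bg) bA) => /= <-.
  by congr (E _); apply/funext => w /=; ring.
- move=> f bf f0; apply: EP; first exact: bounded_measurableM (bm_comp bf) bA.
  by move=> w; apply: mulr_ge0; [exact: f0 | rewrite indicE ler0n].
- move=> a b f g bf bg /=.
  transitivity ((a * E (f \o xi) + b * E (g \o xi)) * E \1_A); last by ring.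
  by congr (_ * _); have := EL a b (bm_comp bf) (bm_comp bg) => /= ->.
- move=> f bf f0; rewrite mulr_ge0// EP//; first exact: bm_comp.
  by move=> w; exact: f0.
- move=> B mB.
  have mxB : measurable (xi @^-1` B).
    by rewrite -[X in measurable X]setTI; case: xi_bm => + _; exact.
  rewrite (_ : (fun w => _) = \1_(xi @^-1` B `&` A)); last first.
    by apply/funext => w; rewrite indicI.
  rewrite (_ : _ \o _ = \1_(xi @^-1` B))//.
  rewrite !expectation_indic//; last exact: measurableI.
  by rewrite xi_indep// fineM// fin_num_measure.
Qed.

(** Same extension in the second factor, on the measurable space whose events
    are [C].  Adding a constant to [xi] makes it nonnegative, so that both sides
    become positive functionals of [eta]. *)
Lemma expectation_indep eta : bmC eta ->
  E (fun w => xi w * eta w) = E xi * E eta.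
Proof.
move=> beta; have [_ [M xiM]] := (bounded_measurableP _).1 xi_bm.
have bmW f := @bounded_measurable_wrtW _ _ R _ C_sigma C_sub f.
have bx : bm (fun w => xi w + cst M w).
  by apply: bounded_measurableD => //; exact: bounded_measurable_cst.
have x0 w : 0 <= xi w + cst M w by have := xiM w; rewrite ler_norml /=; lra.
have Ex0 : 0 <= E (fun w => xi w + cst M w) by exact: EP.
have Exy f : bm f -> E (fun w => (xi w + cst M w) * f w) =
    E (fun w => xi w * f w) + M * E f.
  move=> bf; have := EL 1 M (bounded_measurableM xi_bm bf) bf => /=.
  by rewrite mul1r => <-; congr (E _); apply/funext => w /=; ring.
have b1 : bm (cst 1) := bounded_measurable_cst 1.
have Ex : E (fun w => xi w + cst M w) = E xi + M.
  have := EL 1 M xi_bm b1 => /=; rewrite mul1r expectation_cst /= mulr1 => <-.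
  by congr (E _); apply/funext => w /=; ring.
suff : E (fun w => (xi w + cst M w) * eta w) =
    E (fun w => xi w + cst M w) * E eta.
  by rewrite Exy ?Ex; [lra | exact: bmW].
have := @positive_linear_ext _ (g_sigma_algebraType C) _
  (fun f => E (fun w => (xi w + cst M w) * f w))
  (fun f => E (fun w => xi w + cst M w) * E f) _ _ _ _ _ _ beta.
apply.
- move=> a b f g /bmW bf /bmW bg /=.
  have := EL a b (bounded_measurableM bx bf) (bounded_measurableM bx bg) => /= <-.
  by congr (E _); apply/funext => w /=; ring.
- move=> f /bmW bf f0; apply: EP; first exact: bounded_measurableM.
  by move=> w; rewrite mulr_ge0.
- move=> a b f g /bmW bf /bmW bg /=.
  have /= -> := EL a b bf bg; ring.
- by move=> f /bmW bf f0; rewrite mulr_ge0// EP.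
- move=> A; rewrite /measurable/= sigma_algebra_id// => CA.
  rewrite Exy; last exact/bounded_measurable_indic/C_sub.
  by rewrite expectation_indep_indic// Ex; ring.
Qed.

End independence.

(** * Truncated, scaled and shifted estimators *)

Section equivariance.
Context d (T : measurableType d) (R : realType) (C : set_system T).
Context (C_sigma : sigma_algebra setT C) (C_sub : C `<=` measurable).
Context (rho : (T -> R) -> R) (rho_sublin : sublinear_operator rho).
Context (xi : T -> R) (xi_bm : bounded_measurable xi).
Local Notation bm := (@bounded_measurable d T R).
Local Notation bmC := (@bounded_measurable _ (g_sigma_algebraType C) R).
Local Notation estimator := (min_mean_square_estimator rho C).

Let estP := min_mean_square_estimatorP C_sigma C_sub rho_sublin.
Let bmW f := @bounded_measurable_wrtW _ _ R _ C_sigma C_sub f.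

Lemma min_mean_square_estimator_clamp a b e : (forall w, a <= xi w <= b) ->
  estimator xi e -> estimator xi (fun w => clamp a b (e w)).
Proof.
move=> xiab /(estP _ xi_bm)[be e_min]; apply/(estP _ xi_bm).
have bce : bmC (fun w => clamp a b (e w)).
  by apply: bounded_measurable_clamp; case: be.
split=> // eta beta; apply: le_trans (e_min _ beta).
apply: (sublin_mono rho_sublin) => [||w]; last exact: sqr_clamp.
- exact/bounded_measurable_sqr/bounded_measurableB/bmW.
- exact/bounded_measurable_sqr/bounded_measurableB/bmW.
Qed.

Lemma min_mean_square_estimatorZ l e : estimator xi e ->
  estimator (fun w => l * xi w) (fun w => l * e w).
Proof.
move=> /(estP _ xi_bm)[be e_min].
apply/estP; first exact: bounded_measurableZ.
split=> [|eta beta]; first exact: bounded_measurableZ.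
have sqZ f : bmC f -> rho (fun w => (l * xi w - l * f w) ^+ 2) =
    l ^+ 2 * rho (fun w => (xi w - f w) ^+ 2).
  move=> bf; rewrite -(sublin_poshom rho_sublin) ?sqr_ge0//.
    by congr rho; apply/funext => w; ring.
  exact/bounded_measurable_sqr/bounded_measurableB/bmW.
rewrite sqZ//; have [->|l0] := eqVneq l 0.
  rewrite expr0n mul0r -(sublin_cst rho_sublin 0).
  apply: (sublin_mono rho_sublin) => [||w]; last exact: sqr_ge0.
  - apply/bounded_measurable_sqr/bounded_measurableB/bmW => //.
    exact: bounded_measurableZ.
  - exact: bounded_measurable_cst.
have bleta : bmC (fun w => l^-1 * eta w) by exact: bounded_measurableZ.
rewrite [leRHS](_ : _ = rho (fun w => (l * xi w - l * (l^-1 * eta w)) ^+ 2)).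
  by rewrite sqZ// ler_wpM2l ?sqr_ge0//; exact: e_min.
by congr rho; apply/funext => w; rewrite mulVKf.
Qed.

Lemma min_mean_square_estimatorD eta0 e : bmC eta0 -> estimator xi e ->
  estimator (fun w => xi w + eta0 w) (fun w => e w + eta0 w).
Proof.
move=> beta0 /(estP _ xi_bm)[be e_min].
apply/estP; first exact/bounded_measurableD/bmW.
split=> [|eta beta]; first exact: bounded_measurableD.
rewrite [leLHS](_ : _ = rho (fun w => (xi w - e w) ^+ 2)); last first.
  by congr rho; apply/funext => w; ring.
rewrite [leRHS](_ : _ = rho (fun w => (xi w - (eta w - eta0 w)) ^+ 2)).
  exact/e_min/bounded_measurableB.
by congr rho; apply/funext => w; ring.
Qed.

End equivariance.

(** * The best constant approximation *)

Section best_constant.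
Context d (T : measurableType d) (R : realType).
Context (rho : (T -> R) -> R) (rho_sublin : sublinear_operator rho).
Local Notation bm := (@bounded_measurable d T R).

(** The risk is Lipschitz in the constant on [[- M, M]], where [M] bounds [xi],
    and constants outside this interval are beaten by their truncation. *)
Lemma exists_best_constant xi : bm xi -> exists c, forall t,
  rho (fun w => (xi w - c) ^+ 2) <= rho (fun w => (xi w - t) ^+ 2).
Proof.
move=> bxi; have [M M0 xiM] := bounded_measurable_bound bxi.
pose h t := rho (fun w => (xi w - t) ^+ 2).
have bh t : bm (fun w => (xi w - t) ^+ 2).
  apply/bounded_measurable_sqr/bounded_measurableB => //.
  exact: bounded_measurable_cst.
have hle a b : `|a| <= M -> `|b| <= M -> h a <= h b + 4 * M * `|a - b|.
  move=> aM bM; rewrite -[X in _ <= _ + X](sublin_cst rho_sublin).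
  apply: le_trans _ (sublin_subadd rho_sublin _ _) => //; last first.
    exact: bounded_measurable_cst.
  apply: (sublin_mono rho_sublin) => //.
    by apply: bounded_measurableD => //; exact: bounded_measurable_cst.
  move=> w /=; have /andP[x1 x2] := xiM w.
  move: aM bM; rewrite !ler_norml => /andP[a1 a2] /andP[b1 b2].
  by have [ab|ab] := leP b a; [rewrite ger0_norm ?subr_ge0//
    | rewrite ltr0_norm ?subr_lt0//]; nra.
have h_cont : {within `[- M, M], continuous h}.
  apply/subspace_continuousP => x; rewrite /= in_itv/= -ler_norml => xM.
  apply/cvgrPdist_le => e e0.
  have K0 : 0 < 4 * M + 1 by lra.
  near=> y; rewrite -[leLHS]/(`|h x - h y|).
  have yM : `|y| <= M.
    have : `[- M, M]%classic y by near: y; exact: withinT.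
    by rewrite /= in_itv/= -ler_norml.
  have xy : `|x - y| <= e / (4 * M + 1).
    near: y; apply: cvg_within; apply/(@nbhs_normP R R^o).
    exists (e / (4 * M + 1)) => [|z /ltW//]; exact: divr_gt0.
  have : (4 * M) * `|x - y| <= e.
    apply: le_trans (_ : (4 * M + 1) * `|x - y| <= _).
      by rewrite ler_wpM2r// lerDl.
    by rewrite mulrC -ler_pdivlMr.
  have := hle _ _ xM yM; have := hle _ _ yM xM; rewrite (distrC y x) ler_norml; lra.
have MM : - M <= M by lra.
have [c _ cmin] := EVT_min MM h_cont.
exists c => t; apply: le_trans (cmin (clamp (- M) M t) _) _.
  by rewrite in_itv/= clamp_itv.
by apply: (sublin_mono rho_sublin) => // w; exact: sqr_clamp.
Unshelve. all: by end_near. Qed.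

(** First-order condition at the minimum [0] of [t |-> rho ((X - t)^2)].  With
    the constant [- s t / 2], minimality bounds
    [rho (X^2 + s t X)] from below by [rho (X^2)] up to a term of order [s^2],
    while convexity bounds it from above by
    [(1 - s) rho (X^2) + s rho (X^2 + t X)]; divide by [s] and let [s] tend
    to 0. *)
Lemma best_constant_tilt X : bm X ->
  (forall t, rho (fun w => X w ^+ 2) <= rho (fun w => (X w - t) ^+ 2)) ->
  forall t, rho (fun w => X w ^+ 2) <= rho (fun w => X w ^+ 2 + t * X w).
Proof.
move=> bX Xmin t; set m := rho _; set g := rho _.
have bX2 : bm (fun w => X w ^+ 2) by exact: bounded_measurable_sqr.
have bg : bm (fun w => X w ^+ 2 + t * X w).
  by apply: bounded_measurableD => //; exact: bounded_measurableZ.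
have quad s : 0 < s <= 1 -> m <= g + s * t ^+ 2.
  move=> /andP[s0 s1]; have := Xmin (- (s * t / 2)); rewrite -/m => h.
  have b1 : bm (fun w => (1 - s) * X w ^+ 2) by exact: bounded_measurableZ.
  have b2 : bm (fun w => s * (X w ^+ 2 + t * X w)) by exact: bounded_measurableZ.
  have b3 : bm (cst ((s * t / 2) ^+ 2)) by exact: bounded_measurable_cst.
  have b12 := bounded_measurableD b1 b2.
  have : m <= (1 - s) * m + s * g + (s * t / 2) ^+ 2.
    apply: (le_trans h).
    rewrite -(sublin_poshom rho_sublin) ?subr_ge0//.
    rewrite -(sublin_poshom rho_sublin) ?(ltW s0)//.
    rewrite -[X in _ <= _ + X](sublin_cst rho_sublin).
    apply: le_trans _ (lerD (sublin_subadd rho_sublin b1 b2) (lexx _)).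
    apply: le_trans _ (sublin_subadd rho_sublin b12 b3).
    by rewrite le_eqVlt; apply/orP; left; apply/eqP; congr rho;
      apply/funext => w /=; field.
  have : 0 <= t ^+ 2 by exact: sqr_ge0.
  rewrite -(ler_pM2l s0) => t0 mm; nra.
(* with [s = e / (e + t^2)] the remainder [s t^2] is at most [e] *)
apply/ler_addgt0Pr => e e0.
have t0 : 0 <= t ^+ 2 by exact: sqr_ge0.
have et0 : 0 < e + t ^+ 2 by lra.
have s01 : 0 < e / (e + t ^+ 2) <= 1.
  by rewrite divr_gt0//= ler_pdivrMr// mul1r lerDl.
apply: le_trans (quad _ s01) _; rewrite lerD2l mulrAC ler_pdivrMr//.
by rewrite ler_pM2l// lerDr ltW.
Qed.

Context (rho_cont : continuous_from_above rho).

(** The functional [p Y = inf_t rho (Y + t X)] is sublinear, lies below [rho]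
    and satisfies [p X <= 0] and [p (- X) <= 0], so that every linear functional
    below it vanishes at [X].  The first-order condition says exactly that
    [p (X^2) = rho (X^2)]. *)
Lemma centred_maximizer X : bm X ->
  (forall t, rho (fun w => X w ^+ 2) <= rho (fun w => (X w - t) ^+ 2)) ->
  exists P : probability T R, [/\ dominated_probability rho P,
    fine 'E_P[X] = 0 &
    fine 'E_P[fun w => X w ^+ 2] = rho (fun w => X w ^+ 2)].
Proof.
move=> bX Xmin; have tilt := best_constant_tilt bX Xmin.
have bX2 : bm (fun w => X w ^+ 2) by exact: bounded_measurable_sqr.
have btX t : bm (fun w => t * X w) by exact: bounded_measurableZ.
have bF t Y : bm Y -> bm (fun w => Y w + t * X w).
  by move=> bY; exact: bounded_measurableD.
have rtX t : 0 <= rho (fun w => t * X w).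
  have := sublin_subadd rho_sublin bX2 (btX t); have := tilt t; lra.
pose F (t : R) (Y : T -> R) := rho (fun w => Y w + t * X w).
pose p Y := inf [set F t Y | t in setT].
have Flb Y : bm Y -> lbound [set F t Y | t in setT] (- rho (fun w => - 1 * Y w)).
  move=> bY _ [t _ <-]; have bNY := bounded_measurableZ (- 1) bY.
  have := sublin_subadd rho_sublin (bF t _ bY) bNY; have := rtX t.
  rewrite /F (_ : (fun w => _ + _) = (fun w => t * X w)); first lra.
  by apply/funext => w; ring.
have pF Y t : bm Y -> p Y <= F t Y.
  by move=> bY; apply: ge_inf; [eexists; exact: Flb | exists t].
have F0 Y : F 0 Y = rho Y.
  by congr rho; apply/funext => w; rewrite mul0r addr0.
have ps : @sublinear_on R (T -> R) bm p.
  apply: (sublinear_inf (@bounded_measurable_subspace d T R)).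
  - by exists 0.
  - by move=> Y bY; eexists; exact: Flb.
  - move=> s t Y Z _ _ bY bZ; exists (s + t) => //.
    apply: le_trans _ (sublin_subadd rho_sublin (bF s _ bY) (bF t _ bZ)).
    rewrite le_eqVlt; apply/orP; left; apply/eqP; congr rho.
    by apply/funext => w; rewrite !fctE; ring.
  - move=> s a Y _ bY a0; exists (a * s) => //.
    rewrite /F -(sublin_poshom rho_sublin) ?(ltW a0)//; last exact: bF.
    rewrite le_eqVlt; apply/orP; left; apply/eqP; congr rho.
    by apply/funext => w; rewrite /= mulrDr mulrA.
  - exists 0 => //; rewrite F0.
    by rewrite -[leRHS](sublin_cst rho_sublin 0).
have pr Y : bm Y -> p Y <= rho Y by move=> bY; rewrite -F0; exact: pF.
have [P [Pdom PX2 Pp]] := attained_supremum rho_sublin rho_cont ps pr bX2.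
have zero : rho (cst 0) = 0 by exact: sublin_cst.
exists P; split=> //.
- have := le_trans (Pp _ bX) (pF _ (- 1) bX).
  have bNX := bounded_measurableZ (- 1) bX.
  have := le_trans (Pp _ bNX) (pF _ 1 bNX).
  rewrite (linear_functionalZ (-1) (expectation_linear P) bX).
  rewrite /F (_ : (fun w => _) = cst 0); last by apply/funext => w /=; ring.
  rewrite (_ : (fun w => _) = cst 0); last by apply/funext => w /=; ring.
  rewrite zero; lra.
- apply/eqP; rewrite eq_le PX2 pr//=; apply: lb_le_inf.
    by exists (F 0 (fun w => X w ^+ 2)), 0.
  by move=> _ [t _ <-]; exact: tilt.
Qed.

End best_constant.

(** * Estimators under independence *)

(** The cross term [E_P ((xi - c) (eta - c))] vanishes for the centred maximiser
    [P], which makes the best constant [c] optimal among all competitors. *)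
Lemma constant_min_mean_square_estimator (d : measure_display)
    (T : measurableType d) (R : realType) (C : set_system T)
    (rho : (T -> R) -> R) (xi : T -> R) :
  sigma_algebra setT C -> C `<=` measurable ->
  sublinear_operator rho -> continuous_from_above rho ->
  bounded_measurable xi ->
  (forall P : probability T R, dominated_probability rho P ->
     independent_of_sigma_algebra P xi C) ->
  exists c : R, min_mean_square_estimator rho C xi (cst c).
Proof.
move=> C_sigma C_sub rho_sublin rho_cont bxi xi_indep.
have [c cmin] := exists_best_constant rho_sublin bxi.
have bc : bounded_measurable (cst c : T -> R) by exact: bounded_measurable_cst.
pose X w := xi w - cst c w.
have bX : bounded_measurable X by exact: bounded_measurableB.
have Xmin t : rho (fun w => X w ^+ 2) <= rho (fun w => (X w - t) ^+ 2).
  rewrite [leRHS](_ : _ = rho (fun w => (xi w - (c + t)) ^+ 2)).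
    exact: cmin.
  by congr rho; apply/funext => w; rewrite /X /=; ring.
have [P [Pdom EX EX2]] := centred_maximizer rho_sublin rho_cont bX Xmin.
exists c; apply/min_mean_square_estimatorP => //.
split=> [|eta bCeta]; first exact: bounded_measurable_cst.
have beta := bounded_measurable_wrtW C_sigma C_sub bCeta.
pose Z w := eta w - cst c w.
have bCZ : @bounded_measurable _ (g_sigma_algebraType C) R Z.
  by apply: bounded_measurableB => //; exact: bounded_measurable_cst.
have bZ := bounded_measurable_wrtW C_sigma C_sub bCZ.
have EP := expectation_linear P.
have EXZ : fine 'E_P[fun w => X w * Z w] = 0.
  have Exi : fine 'E_P[xi] = c.
    have := linear_functionalB EP bxi bc => /=.
    have := dominated_linear_cst rho_sublin c Pdom => /= ->.
    by rewrite -/X EX => /esym/eqP; rewrite subr_eq0 => /eqP.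
  have := linear_functionalB EP (bounded_measurableM bxi bZ)
    (bounded_measurableZ c bZ) => /=.
  rewrite (linear_functionalZ c EP bZ) /=.
  rewrite (expectation_indep C_sigma C_sub bxi (xi_indep _ Pdom) bCZ) Exi subrr.
  by move=> <-; congr (fine 'E_P[_]); apply/funext => w; rewrite /X /=; ring.
have bX2 := bounded_measurable_sqr bX; have bZ2 := bounded_measurable_sqr bZ.
have bXZ := bounded_measurableM bX bZ.
rewrite -/X -EX2.
have risk : fine 'E_P[fun w => (xi w - eta w) ^+ 2] =
    fine 'E_P[fun w => X w ^+ 2] + fine 'E_P[fun w => Z w ^+ 2].
  have /= := EP 1 (- 2) _ _ (bounded_measurableD bX2 bZ2) bXZ.
  rewrite EXZ mulr0 addr0 mul1r.
  have /= -> := linear_functionalD EP bX2 bZ2 => <-.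
  by congr (fine 'E_P[_]); apply/funext => w; rewrite /X /Z /=; ring.
apply: (@le_trans _ _ (fine 'E_P[fun w => (xi w - eta w) ^+ 2])).
  by rewrite risk lerDl; apply: expectation_positive => // w; exact: sqr_ge0.
by apply: Pdom.2; exact/bounded_measurable_sqr/bounded_measurableB.
Qed.

Theorem proposition5p1 (d : measure_display) (Omega : measurableType d)
    (R : realType) (C : set_system Omega)
    (C_sigma : sigma_algebra setT C) (C_sub : C `<=` measurable)
    (rho : (Omega -> R) -> R) (P0 : probability Omega R)
    (rho_sublin : sublinear_operator rho)
    (rho_cont : continuous_from_above rho)
    (P0_ref : reference_probability rho P0)
    (rho_proper : proper_operator rho P0)
    (xi : Omega -> R) (xi_bm : bounded_measurable xi) :
  [/\ (* i) *)
      forall C1 C2 : R, (forall w, C1 <= xi w <= C2) ->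
        forall etahat, min_mean_square_estimator rho C xi etahat ->
          {ae P0, forall w, C1 <= etahat w <= C2},
      (* ii) *)
      forall l : R, forall etahat etahatl,
        min_mean_square_estimator rho C xi etahat ->
        min_mean_square_estimator rho C (fun w => l * xi w) etahatl ->
          {ae P0, forall w, etahatl w = l * etahat w},
      (* iii) *)
      forall eta0, bounded_measurable_wrt C eta0 ->
        forall etahat etahat0,
        min_mean_square_estimator rho C xi etahat ->
        min_mean_square_estimator rho C (fun w => xi w + eta0 w) etahat0 ->
          {ae P0, forall w, etahat0 w = etahat w + eta0 w}
    & (* iv) *)
      (forall P : probability Omega R, dominated_probability rho P ->
         independent_of_sigma_algebra P xi C) ->
        forall etahat, min_mean_square_estimator rho C xi etahat ->
          exists c : R, {ae P0, forall w, etahat w = c}].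
Proof.
have unique z e1 e2 := @min_mean_square_estimator_unique _ _ _ _ C_sigma C_sub
  _ rho_sublin rho_cont _ rho_proper z e1 e2.
split.
- move=> C1 C2 xiC etahat He.
  have Hc := min_mean_square_estimator_clamp C_sigma C_sub rho_sublin xi_bm xiC He.
  apply: filterS (unique _ _ _ xi_bm He Hc) => w ->.
  by apply: clamp_itv; have /andP[] := xiC w; exact: le_trans.
- move=> l etahat etahatl He Hl.
  apply: unique Hl _; first exact: bounded_measurableZ.
  exact: min_mean_square_estimatorZ.
- move=> eta0 beta0 etahat etahat0 He H0.
  apply: unique H0 _; last exact: min_mean_square_estimatorD.
  apply: bounded_measurableD => //.
  exact: bounded_measurable_wrtW C_sigma C_sub _ beta0.
- move=> xi_indep etahat He.
  have [c Hc] := constant_min_mean_square_estimator C_sigma C_sub rho_sublin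
    rho_cont xi_bm xi_indep.
  by exists c; exact: unique He Hc.
Qed.
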